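(* The functors $\mathscr{K}:\mathbf{bpol}_{\bullet/b}\to\mathbf{P}^2_\bullet$ and $\mathscr{C}_b:\mathbf{P}^2_\bullet\to\mathbf{bpol}_{\bullet/b}$ form an equivalence of categories (that is, they are quasi-inverse to each other).
   Context: A p-site is a triple $\mathbf{a}=(I,A,(A_i)_{i\in I})$ with $I$ a finite set (the base), $A$ a set (the ground), and $A_i\subset A$ for each $i\in I$. Its parting function is $\pi_{\mathbf{a}}:A\to\mathcal{P}(I)$, $\pi_{\mathbf{a}}(a)=\{i\in I: a\in A_i\}$, and its Knit is $\kappa_{\mathbf{a}}=\pi_{\mathbf{a}}(A)\subset\mathcal{P}(I)$. For a function $\varphi:I\to J$, $\hat\varphi:\mathcal{P}(I)\to\mathcal{P}(J)$ is $\hat\varphi(s)=\{\varphi(i):i\in s\}$. Given p-sites $\mathbf{a}=(I,A,(A_i))$ and $\mathbf{b}=(J,B,(B_j))$, a B-map $\mathbf{a}\to\mathbf{b}$ is a pair $(\varphi,f)$ of functions $\varphi:I\to J$, $f:A\to B$ with $\bigcup_{i\in\varphi^{-1}(j)}A_i=f^{-1}(B_j)$ for all $j\in J$. Category $\mathbf{bpol}_{\bullet/b}$: objects are p-sites; a morphism $\mathbf{a}\to\mathbf{b}$ is a function $\varphi:I\to J$ for which there exists $f:A\to B$ such that $(\varphi,f)$ is a B-map $\mathbf{a}\to\mathbf{b}$ (written $[\varphi]_b$ when viewed as a morphism); composition is composition of functions and the identity of $\mathbf{a}$ is $id_I$. Category $\mathbf{P}^2_\bullet$: objects are p-formations, i.e.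 pairs $(I,\mathcal{X})$ with $I$ a finite set and $\mathcal{X}\subset\mathcal{P}(I)$; a morphism $(I,\mathcal{X})\to(J,\mathcal{Y})$ is a function $\varphi:I\to J$ with $\hat\varphi(s)\in\mathcal{Y}$ for all $s\in\mathcal{X}$; composition is composition of functions. The functor $\mathscr{K}$ sends $\mathbf{a}$ to $(I,\kappa_{\mathbf{a}})$ and $[\varphi]_b$ to $\varphi$. The functor $\mathscr{C}_b$ sends $(I,\mathcal{X})$ to the canonical p-site $\mathbf{ca}(I,\mathcal{X})$, which has base $I$, ground $\mathcal{X}$ and profile $\mathcal{X}_i=\{s\in\mathcal{X}:i\in s\}$ ($i\in I$), and sends $\varphi$ to $[\varphi]_b$. *)

(* Defs.v *)
From mathcomp Require Import all_boot.
From mathcomp Require Import boolp classical_sets.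
Set Implicit Arguments.
Unset Strict Implicit.
Unset Printing Implicit Defensive.
Local Open Scope classical_set_scope.

Record category := Category {
  obj :> Type;
  hom : obj -> obj -> Type;
  catid : forall x : obj, hom x x;
  ccomp : forall x y z : obj, hom y z -> hom x y -> hom x z;
  ccompA : forall (x y z t : obj) (h : hom z t) (g : hom y z) (f : hom x y),
    ccomp h (ccomp g f) = ccomp (ccomp h g) f;
  ccomp1l : forall (x y : obj) (f : hom x y), ccomp (catid y) f = f;
  ccomp1r : forall (x y : obj) (f : hom x y), ccomp f (catid x) = f
}.

Record functor (C D : category) := Functor {
  fobj :> C -> D;
  fmap : forall x y : C, hom x y -> hom (fobj x) (fobj y);
  fmap1 : forall x : C, fmap (catid x) = catid (fobj x);
  fmapM : forall (x y z : C) (g : hom y z) (f : hom x y),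
    fmap (ccomp g f) = ccomp (fmap g) (fmap f)
}.

Definition functor_id (C : category) : functor C C :=
  @Functor C C (fun x => x) (fun _ _ f => f) (fun _ => erefl)
    (fun _ _ _ _ _ => erefl).

Section FunctorComp.
Context (C D E : category) (G : functor D E) (F : functor C D).

Lemma functor_comp1 (x : C) : fmap G (fmap F (catid x)) = catid (G (F x)).
Proof. by rewrite !fmap1. Qed.

Lemma functor_compM (x y z : C) (g : hom y z) (f : hom x y) :
  fmap G (fmap F (ccomp g f)) =
  ccomp (fmap G (fmap F g)) (fmap G (fmap F f)).
Proof. by rewrite !fmapM. Qed.

Definition functor_comp : functor C E :=
  @Functor C E (fun x => G (F x)) (fun _ _ f => fmap G (fmap F f))
    functor_comp1 functor_compM.
End FunctorComp.

Record nat_trans (C D : category) (F G : functor C D) := NatTrans {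
  component :> forall x : C, hom (F x) (G x);
  naturality : forall (x y : C) (f : hom x y),
    ccomp (component y) (fmap F f) = ccomp (fmap G f) (component x)
}.

Definition is_iso (C : category) (x y : C) (f : hom x y) : Prop :=
  exists g : hom y x, ccomp g f = catid x /\ ccomp f g = catid y.

Definition naturally_isomorphic (C D : category) (F G : functor C D) : Prop :=
  exists eta : nat_trans F G, forall x : C, is_iso (eta x).

Definition quasi_inverse (C D : category)
    (F : functor C D) (G : functor D C) : Prop :=
  naturally_isomorphic (functor_comp G F) (functor_id C) /\
  naturally_isomorphic (functor_comp F G) (functor_id D).

(* The power set of I is [set I], so subsets of the power set of I are the
   elements of [set (set I)], and the map on power sets induced by [phi] is the
   direct image [fun s => phi @` s]. *)
Record psite := PSite {
  base : finType;
  ground : Type;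
  profile : base -> set ground
}.

Definition parting (a : psite) (x : ground a) : set (base a) :=
  [set i | profile i x].

Definition Knit (a : psite) : set (set (base a)) := range (@parting a).

Definition Bmap (a b : psite)
    (phi : base a -> base b) (f : ground a -> ground b) : Prop :=
  forall j : base b,
    \bigcup_(i in phi @^-1` [set j]) @profile a i = f @^-1` @profile b j.

Record bmorph (a b : psite) := BMorph {
  bfun :> base a -> base b;
  bfunP : exists f : ground a -> ground b, Bmap bfun f
}.

Lemma bmorph_eq (a b : psite) (u v : bmorph a b) : bfun u = bfun v -> u = v.
Proof.
by case: u v => [u uP] [v vP] /= uv; subst v; rewrite (Prop_irrelevance uP vP).
Qed.

Lemma Bmap_id (a : psite) :
  exists f : ground a -> ground a, Bmap (fun i : base a => i) f.
Proof.
exists id => j; apply/seteqP; split => [x [i /= -> //]|x xj].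
by exists j.
Qed.

Lemma Bmap_comp (a b c : psite) (v : bmorph b c) (u : bmorph a b) :
  exists f : ground a -> ground c, Bmap (fun i => v (u i)) f.
Proof.
case: u v => [u [f uf]] [v [g vg]] /=; exists (g \o f) => k.
rewrite comp_preimage -vg; apply/seteqP; split => [x [i /= uik xi]|x [j /= vjk]].
- exists (u i) => //=.
  have : (f @^-1` @profile b (u i)) x by rewrite -uf; exists i.
  by [].
- move=> xj; have : (f @^-1` @profile b j) x by [].
  by rewrite -uf => -[i /= uij xi]; exists i => //=; rewrite uij.
Qed.

Definition bmorph_id (a : psite) : bmorph a a := BMorph (Bmap_id a).

Definition bmorph_comp (a b c : psite) (v : bmorph b c) (u : bmorph a b) :
  bmorph a c := BMorph (Bmap_comp v u).

Lemma bmorph_compA (x y z t : psite)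
    (h : bmorph z t) (g : bmorph y z) (f : bmorph x y) :
  bmorph_comp h (bmorph_comp g f) = bmorph_comp (bmorph_comp h g) f.
Proof. exact: bmorph_eq. Qed.

Lemma bmorph_comp1l (x y : psite) (f : bmorph x y) : bmorph_comp (bmorph_id y) f = f.
Proof. exact: bmorph_eq. Qed.

Lemma bmorph_comp1r (x y : psite) (f : bmorph x y) : bmorph_comp f (bmorph_id x) = f.
Proof. exact: bmorph_eq. Qed.

Definition bpol_b : category :=
  @Category psite bmorph bmorph_id bmorph_comp
    bmorph_compA bmorph_comp1l bmorph_comp1r.

Record pformation := PFormation {
  pbase : finType;
  formation : set (set pbase)
}.

Record pmorph (X Y : pformation) := PMorph {
  pfun :> pbase X -> pbase Y;
  pfunP : forall s : set (pbase X), formation s -> formation (pfun @` s)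
}.

Lemma pmorph_eq (X Y : pformation) (u v : pmorph X Y) : pfun u = pfun v -> u = v.
Proof.
by case: u v => [u uP] [v vP] /= uv; subst v; rewrite (Prop_irrelevance uP vP).
Qed.

Lemma pmorph_idP (X : pformation) (s : set (pbase X)) :
  formation s -> formation ((fun i => i) @` s).
Proof. by rewrite image_id. Qed.

Lemma pmorph_compP (X Y Z : pformation) (v : pmorph Y Z) (u : pmorph X Y)
  (s : set (pbase X)) : formation s -> formation ((fun i => v (u i)) @` s).
Proof. by move=> sX; rewrite -(image_comp u v); do 2!apply: pfunP. Qed.

Definition pmorph_id (X : pformation) : pmorph X X := PMorph (@pmorph_idP X).

Definition pmorph_comp (X Y Z : pformation) (v : pmorph Y Z) (u : pmorph X Y) :
  pmorph X Z := PMorph (pmorph_compP v u).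

Lemma pmorph_compA (x y z t : pformation)
    (h : pmorph z t) (g : pmorph y z) (f : pmorph x y) :
  pmorph_comp h (pmorph_comp g f) = pmorph_comp (pmorph_comp h g) f.
Proof. exact: pmorph_eq. Qed.

Lemma pmorph_comp1l (x y : pformation) (f : pmorph x y) : pmorph_comp (pmorph_id y) f = f.
Proof. exact: pmorph_eq. Qed.

Lemma pmorph_comp1r (x y : pformation) (f : pmorph x y) : pmorph_comp f (pmorph_id x) = f.
Proof. exact: pmorph_eq. Qed.

Definition P2 : category :=
  @Category pformation pmorph pmorph_id pmorph_comp
    pmorph_compA pmorph_comp1l pmorph_comp1r.

Definition Kobj (a : psite) : pformation := PFormation (@Knit a).

Lemma Kmap_subproof (a b : psite) (u : bmorph a b) (s : set (base a)) :
  Knit s -> Knit (u @` s).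
Proof.
case: u => u [f uf] /= [x _ <-]; exists (f x) => //.
apply/seteqP; split => [j /= fxj|_ [i /= xi <-]].
- have : (f @^-1` @profile b j) x by [].
  by rewrite -uf => -[i /= uij xi]; exists i.
- have : (f @^-1` @profile b (u i)) x by rewrite -uf; exists i.
  by [].
Qed.

Definition Kmap (a b : psite) (u : bmorph a b) : pmorph (Kobj a) (Kobj b) :=
  @PMorph (Kobj a) (Kobj b) (bfun u) (@Kmap_subproof a b u).

Lemma Kmap1 (a : psite) : Kmap (bmorph_id a) = pmorph_id (Kobj a).
Proof. exact: pmorph_eq. Qed.

Lemma KmapM (a b c : psite) (v : bmorph b c) (u : bmorph a b) :
  Kmap (bmorph_comp v u) = pmorph_comp (Kmap v) (Kmap u).
Proof. exact: pmorph_eq. Qed.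

Definition K_functor : functor bpol_b P2 := @Functor bpol_b P2 Kobj Kmap Kmap1 KmapM.

(* The coercion [set_type A] is the subtype [{s | s \in A}]. *)
Definition canonical_psite (X : pformation) : psite :=
  @PSite (pbase X) (set_type (@formation X)) (fun i => [set s | (\val s) i]).

Lemma Cmap_subproof (X Y : pformation) (u : pmorph X Y) :
  exists f : ground (canonical_psite X) -> ground (canonical_psite Y),
    @Bmap (canonical_psite X) (canonical_psite Y) u f.
Proof.
have uY (s : set_type (@formation X)) : (u @` \val s) \in @formation Y.
  by apply/mem_set/pfunP/set_mem; case: s.
exists (fun s => exist _ (u @` \val s) (uY s)) => j.
by apply/seteqP; split => [s [i /= uij si]|s [i /= si uij]]; exists i.
Qed.

Definition Cmap (X Y : pformation) (u : pmorph X Y) :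
  bmorph (canonical_psite X) (canonical_psite Y) :=
  @BMorph (canonical_psite X) (canonical_psite Y) (pfun u) (Cmap_subproof u).

Lemma Cmap1 (X : pformation) :
  Cmap (pmorph_id X) = bmorph_id (canonical_psite X).
Proof. exact: bmorph_eq. Qed.

Lemma CmapM (X Y Z : pformation) (v : pmorph Y Z) (u : pmorph X Y) :
  Cmap (pmorph_comp v u) = bmorph_comp (Cmap v) (Cmap u).
Proof. exact: bmorph_eq. Qed.

Definition Cb_functor : functor P2 bpol_b :=
  @Functor P2 bpol_b canonical_psite Cmap Cmap1 CmapM.

(* Main.v *)
From mathcomp Require Import all_boot.
From mathcomp Require Import boolp classical_sets.
Require Import Defs.
Set Implicit Arguments.
Unset Strict Implicit.
Unset Printing Implicit Defensive.
Local Open Scope classical_set_scope.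

(** Both composites leave the base unchanged, so every component of both natural
    isomorphisms is the identity function of a base. This is a morphism between
    a p-site [a] and the canonical p-site of its Knit in both directions: one way
    the ground is mapped by the parting function, the other way by a choice of
    a preimage under the parting function. The Knit of the canonical p-site of
    [(I, X)] is [X] itself. *)

(** At a point [x], the B-map condition for [j] says that [j] lies in the image of [parting x] under
    [phi] exactly when it lies in [parting (f x)]. *)
Lemma Bmap_of_parting (a b : psite) (phi : base a -> base b)
    (f : ground a -> ground b) :
  (forall x, parting (f x) = phi @` parting x) -> Bmap phi f.
Proof.
move=> fP j; apply/seteqP; split=> [x [i /= ij xi]|x /= xj].
- have : parting (f x) j by rewrite fP; exists i.
  by [].
- have : parting (f x) j by [].
  by rewrite fP => -[i xi ij]; exists i.
Qed.

Lemma Bmap_to_canonical (a : psite) :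
  exists f : ground a -> ground (canonical_psite (Kobj a)),
    @Bmap a (canonical_psite (Kobj a)) id f.
Proof.
have xK (x : ground a) : parting x \in @Knit a by apply/mem_set; exists x.
exists (fun x => exist _ (parting x) (xK x)).
(* In a canonical p-site, the parting of a point [s] is by definition the set [s] itself. *)
by apply: Bmap_of_parting => x; rewrite image_id.
Qed.

Lemma Bmap_from_canonical (a : psite) :
  exists f : ground (canonical_psite (Kobj a)) -> ground a,
    @Bmap (canonical_psite (Kobj a)) a id f.
Proof.
have /choice[f fP] (s : set_type (@Knit a)) :
    exists x : ground a, parting x = \val s.
  by case: s => s /= /set_mem[x _ <-]; exists x.
by exists f; apply: Bmap_of_parting => s; rewrite image_id fP.
Qed.

(** The parting function of the canonical p-site is the inclusion of the formation into the power
    set. *)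
Lemma Knit_canonical (X : pformation) :
  @Knit (canonical_psite X) = @formation X.
Proof.
apply/seteqP; split=> [_ [s _ <-]|s sX]; first exact: set_valP.
by exists (exist _ s (mem_set sX)).
Qed.

Definition from_canonical (a : psite) : bmorph (canonical_psite (Kobj a)) a :=
  BMorph (Bmap_from_canonical a).

Definition to_canonical (a : psite) : bmorph a (canonical_psite (Kobj a)) :=
  BMorph (Bmap_to_canonical a).

(** Both sides have underlying function [u], so the chosen preimages on the grounds do not
    matter. *)
Lemma from_canonical_natural (a b : bpol_b) (u : hom a b) :
  ccomp (from_canonical b : hom (functor_comp Cb_functor K_functor b) b)
    (fmap (functor_comp Cb_functor K_functor) u) =
  ccomp (fmap (functor_id bpol_b) u) (from_canonical a).
Proof. exact: bmorph_eq. Qed.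

Lemma from_Knit_canonicalP (X : pformation) (s : set (pbase X)) :
  @Knit (canonical_psite X) s -> formation (id @` s).
Proof. by rewrite Knit_canonical image_id. Qed.

Lemma to_Knit_canonicalP (X : pformation) (s : set (pbase X)) :
  formation s -> @Knit (canonical_psite X) (id @` s).
Proof. by rewrite Knit_canonical image_id. Qed.

Definition from_Knit_canonical (X : pformation) :
    pmorph (Kobj (canonical_psite X)) X :=
  @PMorph (Kobj (canonical_psite X)) X id (@from_Knit_canonicalP X).

Definition to_Knit_canonical (X : pformation) :
    pmorph X (Kobj (canonical_psite X)) :=
  @PMorph X (Kobj (canonical_psite X)) id (@to_Knit_canonicalP X).

Lemma from_Knit_canonical_natural (X Y : P2) (u : hom X Y) :
  ccomp (from_Knit_canonical Y : hom (functor_comp K_functor Cb_functor Y) Y)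
    (fmap (functor_comp K_functor Cb_functor) u) =
  ccomp (fmap (functor_id P2) u) (from_Knit_canonical X).
Proof. exact: pmorph_eq. Qed.

Theorem theorem5p2p3 : quasi_inverse K_functor Cb_functor.
Proof.
split.
- exists (@NatTrans _ _ (functor_comp Cb_functor K_functor) (functor_id bpol_b)
            from_canonical from_canonical_natural) => a.
  (* The ground maps need not be mutually inverse: a morphism is determined by its function on
     bases, here the identity. *)
  by exists (to_canonical a); split; apply: bmorph_eq.
- exists (@NatTrans _ _ (functor_comp K_functor Cb_functor) (functor_id P2)
            from_Knit_canonical from_Knit_canonical_natural) => X.
  by exists (to_Knit_canonical X); split; apply: pmorph_eq.
Qed.
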